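(* Let $X$ be a real normed linear space, $\Gamma\subset X^*$, and $x^*\in X^*$. Then the following statements are equivalent: (1) $x^*$ vanishes relative to $\Gamma$. (2) $\Gamma_\perp\subset(x^* )_\perp$. (3) $x^*$ belongs to the weak$^*$ closed linear span of $\Gamma$, i.e. the weak$^*$ closure of $\mathrm{span}(\Gamma)$. Moreover, if $X$ is reflexive, then each of these statements is equivalent to (4) $x^*\in\overline{\mathrm{span}}(\Gamma)$, the (norm) closed linear span of $\Gamma$.
   Context: All linear spaces are real; $X^*$ is the dual space of $X$. For $\Gamma\subset X^*$, an element $x^*\in X^*$ vanishes relative to $\Gamma$ if, whenever $x\in X$ satisfies $y^*(x)=0$ for all $y^*\in\Gamma$, one has $x^*(x)=0$. The annihilator in $X$ of $\Gamma$ is $\Gamma_\perp:=\{x\in X\mid y^*(x)=0\text{ for all }y^*\in\Gamma\}$, and $(x^* )_\perp:=\{x^*\}_\perp$. *)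

(* Defs.v *)
From HB Require Import structures.
From mathcomp Require Import all_boot all_order all_algebra.
From mathcomp Require Import all_classical all_reals all_analysis.

Set Implicit Arguments.
Unset Strict Implicit.
Unset Printing Implicit Defensive.

Import Order.TTheory GRing.Theory Num.Theory.
Import numFieldNormedType.Exports.

Local Open Scope classical_set_scope.
Local Open Scope ring_scope.

Section span.
Context {R : pzRingType} {V : lmodType R}.

Definition linear_span (A : set V) : set V :=
  [set v | exists (n : nat) (a : 'I_n -> R) (u : 'I_n -> V),
    (forall i, A (u i)) /\ v = \sum_(i < n) a i *: u i].

End span.

Section dual.
Context {R : realType} (X : normedModType R).

Definition continuous_linear : {pred X -> R^o} :=
  [pred f : X -> R^o | `[< linear f /\ continuous f >]].

Record dual_space : Type := Dual {
  dual_fun :> X -> R^o ;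
  dual_continuous_linear : dual_fun \in continuous_linear }.

HB.instance Definition _ := [isSub for dual_fun].
HB.instance Definition _ := [Choice of dual_space by <:].

Fact continuous_linear_submod_closed : submod_closed continuous_linear.
Proof.
split.
  apply/asboolP; split; last by move=> x; exact: cst_continuous.
  by move=> a x y /=; rewrite scaler0 addr0.
move=> a f g /asboolP[lf cf] /asboolP[lg cg]; apply/asboolP; split.
  move=> b x y; rewrite addrfctE scalrfctE lf lg.
  by rewrite !scalerDr !scalerA (mulrC a b) addrACA.
by move=> x; apply: (@cvgD R R^o); [apply: cvgZl_tmp; exact: cf|exact: cg].
Qed.

HB.instance Definition _ := GRing.isSubmodClosed.Build R (X -> R^o)
  continuous_linear continuous_linear_submod_closed.
HB.instance Definition _ := [SubChoice_isSubLmodule of dual_space by <:].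

Fact dual_linear (f : dual_space) : linear f.
Proof. by have /asboolP[] := dual_continuous_linear f. Qed.

Fact dual_continuous (f : dual_space) : continuous f.
Proof. by have /asboolP[] := dual_continuous_linear f. Qed.

HB.instance Definition _ (f : dual_space) :=
  GRing.isLinear.Build R X R^o *:%R (dual_fun f) (dual_linear f).

Definition dual_norm (f : dual_space) : R :=
  sup [set `|f x| | x in [set x : X | `|x| <= 1]].

Fact dual_norm_has_sup (f : dual_space) :
  has_sup [set `|f x| | x in [set x : X | `|x| <= 1]].
Proof.
split; first by exists `|f 0|, 0 => //=; rewrite normr0.
have /linear_bounded_continuous/linear_boundedP/pinfty_ex_gt0[M M0 fM] :
  continuous (dual_fun f) by exact: dual_continuous.
exists M => _ [x /= x1 <-].
by rewrite (le_trans (fM x))// ger_pMr.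
Qed.

Fact dual_norm_ub (f : dual_space) (x : X) : `|x| <= 1 -> `|f x| <= dual_norm f.
Proof.
move=> x1; apply: ub_le_sup; last by exists x.
by case: (dual_norm_has_sup f).
Qed.

Fact dual_norm_le (f : dual_space) (M : R) :
  (forall x : X, `|x| <= 1 -> `|f x| <= M) -> dual_norm f <= M.
Proof.
move=> fM; apply: ge_sup; first by case: (dual_norm_has_sup f).
by move=> _ [x x1 <-]; exact: fM.
Qed.

Fact dual_norm_ge0 (f : dual_space) : 0 <= dual_norm f.
Proof. by apply: le_trans (dual_norm_ub (x := 0) f _); rewrite ?normr0. Qed.

Fact ler_dual_normD (f g : dual_space) :
  dual_norm (f + g) <= dual_norm f + dual_norm g.
Proof.
apply: dual_norm_le => x x1.
by rewrite (le_trans (ler_normD _ _))// lerD// dual_norm_ub.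
Qed.

Fact dual_normZ (a : R) (f : dual_space) : dual_norm (a *: f) = `|a| * dual_norm f.
Proof.
have le_normZ b (g : dual_space) : dual_norm (b *: g) <= `|b| * dual_norm g.
  apply: dual_norm_le => x x1.
  by rewrite [leLHS]normrM ler_wpM2l// dual_norm_ub.
apply/eqP; rewrite eq_le le_normZ/=.
have [->|a0] := eqVneq a 0; first by rewrite normr0 mul0r dual_norm_ge0.
rewrite -[in leLHS](scale1r f) -(mulVf a0) -scalerA.
rewrite (le_trans (ler_wpM2l _ (le_normZ _ _)))// mulrA -normrM divff//.
by rewrite normr1 mul1r.
Qed.

Fact dual_norm_eq0 (f : dual_space) : dual_norm f = 0 -> f = 0.
Proof.
move=> f0; apply/val_inj/funext => x /=.
have [->|x0] := eqVneq x 0; first by rewrite linear0.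
have : `|f (`|x|^-1 *: x)| <= 0.
  rewrite -f0 dual_norm_ub// normrZ normfV normr_id mulVf ?normr_eq0//.
rewrite normr_le0 linearZ/= mulf_eq0 invr_eq0 normr_eq0 (negbTE x0)/=.
by move/eqP.
Qed.

HB.instance Definition _ :=
  @Lmodule_isNormed.Build R dual_space dual_norm ler_dual_normD dual_normZ
    dual_norm_eq0.

Fact dual_norm_bound (f : dual_space) (x : X) : `|f x| <= `|f| * `|x|.
Proof.
have [->|x0] := eqVneq x 0; first by rewrite linear0 !normr0 mulr0.
rewrite -ler_pdivrMr ?normr_gt0//.
have -> : `|f x| / `|x| = `|f (`|x|^-1 *: x)|.
  by rewrite linearZ/= normrM normfV normr_id mulrC.
by rewrite dual_norm_ub// normrZ normfV normr_id mulVf ?normr_eq0.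
Qed.

(* The topology of pointwise convergence on X, inherited by the dual. *)
Definition weak_star : Type :=
  initial_topology (fun f : dual_space => dual_fun f : {ptws X -> R^o}).

HB.instance Definition _ := Topological.copy weak_star
  (initial_topology (fun f : dual_space => dual_fun f : {ptws X -> R^o})).

Definition weak_star_closure (A : set dual_space) : set dual_space :=
  @closure weak_star A.

Definition annihilator (G : set dual_space) : set X :=
  [set x | forall y : dual_space, G y -> y x = 0].

Definition vanishes_relative (G : set dual_space) (f : dual_space) : Prop :=
  forall x : X, (forall y : dual_space, G y -> y x = 0) -> f x = 0.

End dual.

Section reflexive.
Context {R : realType} (X : normedModType R).

Fact evaluation_continuous_linear (x : X) :
  (fun f : dual_space X => f x : R^o) \in (@continuous_linear R (dual_space X)).
Proof.
have lin : linear (fun f : dual_space X => f x : R^o) by [].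
apply/asboolP; split=> //.
pose ev := HB.pack_for {linear dual_space X -> R^o}
  (fun f : dual_space X => f x : R^o)
  (GRing.isLinear.Build R (dual_space X) R^o *:%R _ lin).
apply: (@bounded_linear_continuous R (dual_space X) R^o ev).
apply/linear_boundedP; exists `|x|; split; first exact: num_real.
move=> r /ltW xr f; rewrite (le_trans (dual_norm_bound f x))//.
by rewrite mulrC ler_wpM2r.
Qed.

Definition bidual_embedding (x : X) : dual_space (dual_space X) :=
  Dual (evaluation_continuous_linear x).

Definition reflexive_space : Prop :=
  range bidual_embedding = [set: dual_space (dual_space X)].

End reflexive.

(* Main.v *)
Require Import Defs.
From HB Require Import structures.
From mathcomp Require Import all_boot all_order all_algebra.
From mathcomp Require Import all_classical all_reals all_analysis.
From mathcomp Require Import ring lra.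

(** That [xs] vanishes relative to [Gamma] and that the annihilator of [Gamma] lies
in that of [xs] say the same thing. If [xs] is in the weak-star closure of the
span, it vanishes relative to [Gamma] because evaluation at a point [x] is
weak-star continuous: being zero on [Gamma], it is zero on the span and hence on
its weak-star closure.

Conversely, a functional that vanishes relative to [Gamma] is in the weak-star
closure by finite-dimensional linear algebra. A weak-star neighbourhood of [xs]
contains every functional that agrees with [xs] at some finite list of points
([nbhs_weak_star_finite]), so it is enough to match [xs] exactly at finitely
many points by an element of the span. This is [interpolation], proved by
induction on the list of points with one elimination step per point.

Evaluations are also norm continuous on the dual, so membership in the norm
closed span again implies vanishing relative to [Gamma]. For the converse in a
reflexive space, suppose that [xs] is not in the norm closure of the span. The
Hahn-Banach theorem gives an element of the bidual that vanishes on the span but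
not at [xs] ([closure_separation]). By reflexivity it is the evaluation at some
[x] in [X]; this [x] is annihilated by [Gamma] but not by [xs].

The Hahn-Banach theorem is obtained from Zorn's lemma on graphs: a partial
linear functional on [V] is a subspace of [V * R], and domination by a sublinear
[p] forces such a subspace to be single-valued. *)

Set Implicit Arguments.
Unset Strict Implicit.
Unset Printing Implicit Defensive.

Import Order.TTheory GRing.Theory Num.Theory.
Import numFieldNormedType.Exports.

Local Open Scope classical_set_scope.
Local Open Scope ring_scope.

(** * Subspaces and linear spans *)

Section subspaces.
Context {R : pzRingType} {V : lmodType R}.

Definition linear_subspace (W : set V) : Prop :=
  W 0 /\ forall a u v, W u -> W v -> W (a *: u + v).

Lemma subspaceD W u v : linear_subspace W -> W u -> W v -> W (u + v).
Proof. by case=> _ WL Wu Wv; rewrite -[u]scale1r; exact: WL. Qed.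

Lemma subspaceZ W a u : linear_subspace W -> W u -> W (a *: u).
Proof. by case=> W0 WL Wu; rewrite -[_ *: _]addr0; exact: WL. Qed.

Lemma linear_span_subspace (A : set V) : linear_subspace (linear_span A).
Proof.
split.
  exists 0%N, (fun=> 0), (fun=> 0); split; first by case.
  by rewrite big_ord0.
move=> c _ _ [n [a [u [Au ->]]]] [m [b [v [Av ->]]]].
exists (n + m)%N, (fun i =>
    match fintype.split i with inl j => c * a j | inr j => b j end),
  (fun i => match fintype.split i with inl j => u j | inr j => v j end); split.
  by move=> i; case: fintype.split.
rewrite big_split_ord /= scaler_sumr; congr (_ + _).
  apply: eq_bigr => i _; rewrite -[lshift _ _]/(unsplit (inl i)) unsplitK.
  by rewrite scalerA.
by apply: eq_bigr => i _; rewrite -[rshift _ _]/(unsplit (inr i)) unsplitK.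
Qed.

Lemma sub_linear_span (A : set V) : A `<=` linear_span A.
Proof.
move=> v Av; exists 1%N, (fun=> 1), (fun=> v); split=> //.
by rewrite big_ord1 scale1r.
Qed.

End subspaces.

(** * The Hahn-Banach theorem *)

Section hahn_banach.
Context {R : realType} {V : lmodType R} (p : V -> R).
Hypothesis pD : forall u v, p (u + v) <= p u + p v.
Hypothesis pZ : forall a v, 0 <= a -> p (a *: v) = a * p v.

(** A partial linear functional, encoded by its graph so that Zorn's lemma applies
to inclusion of sets; domination by [p] is what makes it single-valued. *)
Definition dominated_graph (G : set (V * R^o)) : Prop :=
  linear_subspace G /\ forall u, G u -> u.2 <= p u.1.

(** If [r] and [s] are both values at [v], then the graph contains [(0, r - s)] and
[(0, s - r)], and [p 0 = 0] bounds both second components. *)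
Lemma dominated_graph_functional G v r s : dominated_graph G ->
  G (v, r) -> G (v, s) -> r = s.
Proof.
move=> [[_ GL] Gp].
have le x y : G (v, x) -> G (v, y) -> y <= x.
  move=> Gx Gy; have := Gp _ (GL (-1) _ _ Gx Gy).
  rewrite /= !scaleN1r addNr.
  by rewrite -[X in p X](scale0r 0) pZ// mul0r addrC subr_le0.
by move=> Gr Gs; apply/eqP; rewrite eq_le !le.
Qed.

(** The one-dimensional extension step. A value [c] at [x] is admissible when
[r - p (v - x) <= c <= p (w + x) - s] for all [(v, r)] and [(w, s)] in [G]. Every
left side is at most every right side, because
[r + s <= p (v + w) <= p (v - x) + p (w + x)]; so the supremum of the left sides
is a valid choice. *)
Lemma dominated_graph_extend G x : dominated_graph G ->
  exists2 G', dominated_graph G' & G `<=` G' /\ exists c, G' (x, c).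
Proof.
move=> [GS Gp]; have [G0 GL] := GS.
pose A := [set u.2 - p (u.1 - x) | u in G].
have Aub w : G w -> ubound A (p (w.1 + x) - w.2).
  move=> Gw _ [u Gu <-]; rewrite lerBrDr addrAC lerBlDr.
  apply: le_trans (Gp _ (subspaceD GS Gu Gw)) _.
  have -> : (u + w).1 = (w.1 + x) + (u.1 - x) by rewrite addrACA subrr addr0 addrC.
  exact: pD.
have Asup : has_sup A.
  split; first by exists (0 - p (0 - x)), (0, 0).
  by exists (p (0 + x) - 0); exact: (Aub (0, 0)).
pose c := sup A.
have cge u : G u -> u.2 - p (u.1 - x) <= c.
  by move=> Gu; apply: ub_le_sup; [case: Asup|exists u].
have cle w : G w -> c <= p (w.1 + x) - w.2.
  by move=> Gw; apply: ge_sup; [case: Asup|exact: Aub].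
exists [set w | exists2 u, G u & exists a : R, w = u + a *: (x, c : R^o)].
  split; first split.
  - by exists 0 => //; exists 0; rewrite scale0r addr0.
  - move=> a _ _ [u Gu [b ->]] [v Gv [d ->]].
    exists (a *: u + v); first exact: GL.
    by exists (a * b + d); rewrite scalerDr scalerA addrACA -scalerDl.
  (* By homogeneity, the bound at [u + a *: x] reduces to the bound on [c] at
     [u / (- a)] when [a < 0] and at [u / a] when [a > 0]. *)
  move=> _ [u Gu [a ->]] /=; have [a0|a0|->] := ltgtP a 0.
  - have na : 0 < - a by rewrite oppr_gt0.
    have /= := cge _ (subspaceZ (- a)^-1 GS Gu).
    rewrite -(ler_pM2l na) mulrBr -(pZ _ (ltW na)) scalerBr !scalerA !mulfV ?gt_eqF//.
    rewrite scale1r scaleNr opprK mulrA mulfV ?gt_eqF// mul1r.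
    by rewrite -[a *: c]/(a * c); lra.
  - have /= := cle _ (subspaceZ a^-1 GS Gu).
    rewrite -(ler_pM2l a0) mulrBr -(pZ _ (ltW a0)) scalerDr !scalerA !mulfV ?gt_eqF//.
    rewrite scale1r mulrA mulfV ?gt_eqF// mul1r.
    by rewrite -[a *: c]/(a * c); lra.
  - by rewrite !scale0r !addr0 Gp.
split; last by exists c, 0 => //; exists 1; rewrite scale1r add0r.
by move=> u Gu; exists u => //; exists 0; rewrite scale0r addr0.
Qed.

(** Upper bounds of chains. The union with [G0] on both sides makes the statement
hold for the empty chain too. *)
Lemma dominated_graph_bigcup (G0 : set (V * R^o)) (F : set (set (V * R^o))) :
  dominated_graph G0 -> (forall A, F A -> dominated_graph (A `|` G0)) ->
  total_on F subset -> dominated_graph ((\bigcup_(A in F) A) `|` G0).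
Proof.
move=> dG0 dF totF.
(* The conditions on a dominated graph involve at most two points at a time, and
   two points of the union always lie in a single dominated graph. *)
have common u v : ((\bigcup_(A in F) A) `|` G0) u ->
    ((\bigcup_(A in F) A) `|` G0) v ->
    exists Z, [/\ dominated_graph Z, Z u, Z v &
                  Z `<=` (\bigcup_(A in F) A) `|` G0].
  have FZ A : F A -> A `|` G0 `<=` (\bigcup_(A in F) A) `|` G0.
    by move=> FA; apply: setSU; exact: bigcup_sup.
  case=> [[A FA Au]|Gu] [[B FB Bv]|Gv].
  - have [AB|BA] := totF _ _ FA FB.
    + exists (B `|` G0); split; [exact: dF|left; exact: AB|by left|exact: FZ].
    + exists (A `|` G0); split; [exact: dF|by left|left; exact: BA|exact: FZ].
  - by exists (A `|` G0); split; [exact: dF|left|right|exact: FZ].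
  - by exists (B `|` G0); split; [exact: dF|right|left|exact: FZ].
  - by exists G0; split=> //; exact: subsetUr.
split; first split.
- by right; case: dG0 => -[].
- move=> a u v Uu Uv; have [Z [[[_ ZL] _] Zu Zv ZU]] := common _ _ Uu Uv.
  exact/ZU/ZL.
- move=> u Uu; have [Z [[_ Zp] Zu _ _]] := common _ _ Uu Uu.
  exact: Zp.
Qed.

(** A maximal dominated graph containing [G0] has full domain, since it could
otherwise be extended; being single-valued, it is then the graph of a linear
form. *)
Theorem Hahn_Banach (G0 : set (V * R^o)) : dominated_graph G0 ->
  exists f : V -> R^o, [/\ linear f, forall v, f v <= p v &
    forall u, G0 u -> f u.1 = u.2].
Proof.
move=> dG0.
(* Zorn's lemma is applied to the sets whose union with [G0] is dominated, which
   keeps the empty chain harmless and makes every graph considered extend [G0]. *)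
have [|A [dA Amax]] := @Zorn_bigcup _ [set A | dominated_graph (A `|` G0)].
  by move=> F FP totF; exact: dominated_graph_bigcup.
pose G := A `|` G0; have [[_ GL] Gp] := dA.
have Gtotal v : exists r, G (v, r).
  have [G' dG' [GG' [c G'c]]] := dominated_graph_extend v dA.
  have G0G' : G' `|` G0 = G'.
    by apply/setUidl => u G0u; apply: GG'; right.
  have [vA|vA] := pselect (A (v, c)); first by exists c; left.
  have /Amax : A `<` G'.
    split=> [u Au|G'A]; [by apply: GG'; left|exact/vA/G'A].
  by case; rewrite /= G0G'.
have [f Gf] := choice Gtotal; exists f; split=> [a u v|v|[v r] Gv].
- apply: (dominated_graph_functional dA (Gf _)).
  exact: (GL a _ _ (Gf u) (Gf v)).
- exact: (Gp _ (Gf v)).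
- by apply: (dominated_graph_functional dA (Gf _)); right.
Qed.

End hahn_banach.

(** * Separating a point from the closure of a subspace *)

Section separation.
Context {R : realType} {V : normedModType R}.

(** Some ball of radius [d] around [z] misses [M], so on the span of [M] and [z] the
form [m + t *: z |-> t * d] is dominated by the norm. Its Hahn-Banach extension is
dominated by the norm as well, which makes it continuous. *)
Lemma closure_separation (M : set V) (z : V) : linear_subspace M ->
  ~ closure M z ->
  exists2 F : dual_space V, forall m, M m -> F m = 0 & F z != 0.
Proof.
move=> MS zM; have [M0 ML] := MS.
have [d d0 Md] : exists2 d : R, 0 < d & forall m, M m -> d <= `|z - m|.
  move/existsNP : zM => [B /not_implyP[/nbhs_ballP[d d0 dB] MB]].
  exists d => // m Mm; rewrite leNgt; apply/negP => zm; apply: MB.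
  by exists m; split=> //; apply: dB; rewrite -ball_normE.
pose G0 := [set w : V * R^o | exists2 m, M m &
  exists t : R, w = (m + t *: z, t * d)].
have dG0 : dominated_graph (fun v : V => `|v|) G0.
  split; first split.
  - by exists 0 => //; exists 0; rewrite scale0r addr0 mul0r.
  - move=> a _ _ [m Mm [t ->]] [n Mn [s ->]]; exists (a *: m + n); first exact: ML.
    exists (a * t + s); apply/pair_equal_spec; split => /=.
      by rewrite scalerDr scalerA addrACA -scalerDl.
    by rewrite -[a *: (t * d)]/(a * (t * d)) mulrA mulrDl.
  - move=> _ [m Mm [t ->]] /=; have [->|t0] := eqVneq t 0; first by rewrite mul0r.
    have -> : m + t *: z = t *: (z - (- t^-1) *: m).
      by rewrite scaleNr opprK scalerDr scalerA mulfV// scale1r addrC.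
    rewrite normrZ (@le_trans _ _ (`|t| * d))//.
      by rewrite (ler_wpM2r (ltW d0))// ler_norm.
    by rewrite ler_wpM2l//; apply: Md; exact: subspaceZ.
have [f [fL fle fG]] := Hahn_Banach (@ler_normD _ _)
  (fun a v a0 => etrans (normrZ a v) (congr1 ( *%R^~ _) (ger0_norm a0))) dG0.
have fC : f \in @continuous_linear R V.
  apply/asboolP; split=> //.
  pose fl := HB.pack_for {linear V -> R^o} f
    (GRing.isLinear.Build R V R^o *:%R _ fL).
  apply: (@bounded_linear_continuous R V R^o fl).
  apply/linear_boundedP; exists 1; split; first exact: num_real.
  move=> r /ltW r1 v; rewrite (@le_trans _ _ `|v|) ?ler_peMl//.
  rewrite ler_norml (fle v) andbT lerNl -normrN.
  by rewrite -[- fl v](linearN fl) fle.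
exists (Dual fC) => [m Mm|] /=.
  rewrite (fG (m, 0))//; exists m => //; exists 0.
  by rewrite scale0r addr0 mul0r.
rewrite (fG (z, d)) /=; first by rewrite gt_eqF.
by exists 0 => //; exists 1; rewrite add0r scale1r mul1r.
Qed.

End separation.

(** * The weak-star topology and finite interpolation *)

Section weak_star.
Context {R : realType} {X : normedModType R}.
Implicit Types (W G : set (dual_space X)) (f : dual_space X).

Lemma vanishes_relative_span G f :
  vanishes_relative G f -> vanishes_relative (linear_span G) f.
Proof. by move=> Gf x Wx; apply: Gf => y Gy; apply/Wx/sub_linear_span. Qed.

Lemma annihilator_span G x : annihilator G x -> annihilator (linear_span G) x.
Proof.
move=> Gx _ [n [a [u [Gu ->]]]].
pose ev (g : dual_space X) : R^o := g x.
have -> : (\sum_(i < n) a i *: u i) x = \sum_(i < n) a i *: ev (u i).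
  by elim/big_ind2 : _ => // g r h s; rewrite /= => <- <-.
by rewrite big1// => i _; rewrite /ev Gx// scaler0.
Qed.

(** Induction on the list of points. If every element of [W] vanishes at the first
point [x], so does [f], and there is nothing to match there. Otherwise take [w0] in
[W] with [w0 x = 1]. Subtracting [f x *: w0] from [f] and passing to the
elements of [W] that vanish at [x] reduces to the remaining points, provided that
the hypothesis on [f] survives, which is [W'f]: if those elements kill [y], then
[W] kills [y - w0 y *: x]. *)
Lemma interpolation (s : seq X) W f : linear_subspace W ->
  vanishes_relative W f -> exists2 w, W w & {in s, forall x, w x = f x}.
Proof.
elim: s W f => [|x s IHs] W f WS Wf.
  by exists 0 => //; case: WS.
have [W0 WL] := WS.
have [[w0 Ww0 w0x]|W_x] := pselect (exists2 w, W w & w x = 1); last first.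
  have Wx w : W w -> w x = 0.
    move=> Ww; apply/eqP/negPn/negP => wx; apply: W_x.
    exists ((w x)^-1 *: w); first exact: subspaceZ.
    exact: mulVf.
  have [w Ww ws] := IHs _ _ WS Wf; exists w => // y.
  rewrite inE => /predU1P[->|/ws//]; by rewrite Wx// Wf.
pose W' := [set w | W w /\ w x = 0].
have W'S : linear_subspace W'.
  split; first by [].
  move=> a u v [Wu ux] [Wv vx]; split; first exact: WL.
  by rewrite -[LHS]/(a * u x + v x) ux vx mulr0 addr0.
have W'f : vanishes_relative W' (- f x *: w0 + f).
  move=> y W'y; rewrite -[LHS]/(- f x * w0 y + f y).
  suff : f (- w0 y *: x + y) = 0.
    by rewrite linearP /= -[_ *: f x]/(- w0 y * f x) => <-; ring.
  apply: Wf => w Ww; rewrite linearP /= -[_ *: w x]/(- w0 y * w x).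
  have /W'y : W' (- w x *: w0 + w).
    split; first exact: WL.
    by rewrite -[LHS]/(- w x * w0 x + w x) w0x mulr1 addNr.
  by rewrite -[X in X = 0 -> _]/(- w x * w0 y + w y) => <-; ring.
have [w [Ww wx] ws] := IHs _ _ W'S W'f.
exists (f x *: w0 + w); first exact: WL.
move=> y; rewrite -[LHS]/(f x * w0 y + w y) inE => /predU1P[->|/ws ->].
  by rewrite w0x wx mulr1 addr0.
by rewrite -[(_ + f) y]/(- f x * w0 y + f y); ring.
Qed.

(** The sets that contain all functions agreeing with [f] on some finite list form
a filter. It converges pointwise to [f], hence it contains the neighbourhoods
of [f]. *)
Lemma nbhs_weak_star_finite f (B : set (weak_star X)) :
  nbhs (f : weak_star X) B ->
  exists s : seq X, forall g : dual_space X, {in s, g =1 f} -> B g.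
Proof.
move=> [_ [[C oC <-] Cf CB]].
pose Fin : set_system {ptws X -> R^o} := [set A | exists s : seq X,
  forall g : X -> R^o, {in s, g =1 f} -> A g].
have FinF : Filter Fin.
  split; first by exists [::].
  - move=> P Q [s sP] [t tQ]; exists (s ++ t) => g gst; split.
      by apply: sP => x xs; apply: gst; rewrite mem_cat xs.
    by apply: tQ => x xt; apply: gst; rewrite mem_cat xt orbT.
  - by move=> P Q PQ [s sP]; exists s => g /sP/PQ.
have Fincvg : Fin --> (dual_fun f : {ptws X -> R^o}).
  apply/cvg_sup => x U [_ [[D oD <-] Df DU]].
  exists [:: x] => g gx; apply: DU.
  by rewrite /= /proj gx// mem_head.
have [|s sC] := Fincvg C; first by apply: open_nbhs_nbhs; split.
by exists s => g gs; apply: CB; exact: sC.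
Qed.

Lemma vanishes_weak_star_closure W f : linear_subspace W ->
  vanishes_relative W f -> weak_star_closure W f.
Proof.
move=> WS Wf B /nbhs_weak_star_finite[s sB].
have [w Ww ws] := interpolation s WS Wf.
by exists w; split=> //; exact: sB.
Qed.

Lemma evaluation_weak_star_continuous (x : X) :
  continuous (fun f : weak_star X => (f : dual_space X) x).
Proof.
move=> f; pose j (g : dual_space X) : {ptws X -> R^o} := dual_fun g.
have jf : {for f, continuous (j : weak_star X -> {ptws X -> R^o})}.
  exact: (@initial_continuous _ _ j).
exact: (continuous_comp jf (@proj_continuous X (fun=> R^o) x (j f))).
Qed.

Lemma continuous_eq0_closure (T : topologicalType) (h : T -> R) (A : set T) (f : T) :
  continuous h -> (forall y, A y -> h y = 0) -> closure A f -> h f = 0.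
Proof.
move=> hc hA.
have cl : closed (h @^-1` [set 0]).
  by apply: preimage_closed => [y _|]; [exact: hc|exact: closed_eq].
by move=> /(closureS hA); rewrite -(closure_id _).1.
Qed.

End weak_star.

(** * The equivalences *)

Theorem theorem4p3 (R : realType) (X : normedModType R)
    (Gamma : set (dual_space X)) (xs : dual_space X) :
  [<-> vanishes_relative Gamma xs;
       annihilator Gamma `<=` annihilator [set xs];
       weak_star_closure (linear_span Gamma) xs]
  /\
  (reflexive_space X ->
   [<-> vanishes_relative Gamma xs;
        annihilator Gamma `<=` annihilator [set xs];
        weak_star_closure (linear_span Gamma) xs;
        closure (linear_span Gamma) xs]).
Proof.
have span_sub := linear_span_subspace Gamma.
have v_ann : vanishes_relative Gamma xs ->
    annihilator Gamma `<=` annihilator [set xs].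
  by move=> vxs x Gx _ ->; exact: vxs.
have ann_v : annihilator Gamma `<=` annihilator [set xs] ->
    vanishes_relative Gamma xs.
  by move=> Gxs x Gx; exact: (Gxs x Gx xs).
have ann_ws : annihilator Gamma `<=` annihilator [set xs] ->
    weak_star_closure (linear_span Gamma) xs.
  by move=> /ann_v/vanishes_relative_span; exact: vanishes_weak_star_closure.
have ws_v : weak_star_closure (linear_span Gamma) xs -> vanishes_relative Gamma xs.
  move=> wxs x Gx.
  exact: (@continuous_eq0_closure _ (weak_star X) _ _ _
    (@evaluation_weak_star_continuous R X x) (annihilator_span Gx) wxs).
split; first by tfae.
move=> reflX; tfae=> // [/ws_v vxs|cxs x Gx].
  apply: contrapT => /(closure_separation span_sub)[F F0 /eqP[]].
  have [x _ xF] : range (@bidual_embedding R X) F by rewrite reflX.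
  rewrite -xF; apply: vxs => y /sub_linear_span/F0.
  by rewrite -xF.
exact: (@continuous_eq0_closure _ (dual_space X) _ _ _
  (@dual_continuous R (dual_space X) (bidual_embedding x)) (annihilator_span Gx) cxs).
Qed.
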